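(* Let $X$ be a separable Banach space with property $U$ in its bidual $X^{**}$. Then $X$ admits an equivalent very smooth norm $|\cdot|$ such that $(X,|\cdot|)$ is totally smooth in its bidual $(X,|\cdot|)^{**}$.
   Context: Banach spaces are over $\mathbb K=\mathbb R$ or $\mathbb C$. A Banach space $X$ is regarded as a subspace of $X^{**}$ via the canonical embedding. A subspace $X$ of a Banach space $Z$ has property $U$ in $Z$ if every functional $x^*\in X^*$ has a unique norm-preserving extension $z^*\in Z^*$. A Banach space $X$ is totally smooth in $Z\supset X$ if every closed subspace $Y$ of $X$ has property $U$ in $Z$. A Banach space $X$ is smooth if for every $x$ in the unit sphere $S_X$ there is a unique $f_x\in S_{X^*}$ with $f_x(x)=1$; a smooth space is very smooth if the support mapping $x\mapsto f_x$ from $S_X$ to $S_{X^*}$ is norm-to-weak continuous (weak topology of $X^*$). A norm is very smooth if the space with this norm is. *)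

(* Defs.v *)
From HB Require Import structures.
From mathcomp Require Import all_boot all_order all_algebra complex.
From mathcomp Require Import all_classical all_reals all_analysis.

Set Implicit Arguments.
Unset Strict Implicit.
Unset Printing Implicit Defensive.
Import Order.TTheory GRing.Theory Num.Theory.
Import numFieldNormedType.Exports.
Local Open Scope classical_set_scope.
Local Open Scope ring_scope.

Variant scalar_kind := RealScalars | ComplexScalars.

Definition scalar_field (R : realType) (k : scalar_kind) : numFieldType :=
  match k with RealScalars => R | ComplexScalars => R[i] end.

(* The library's norms take values in the scalar field; suprema are taken in
   R, through the two maps below. *)
Definition scalar_re (R : realType) (k : scalar_kind) : scalar_field R k -> R :=
  match k with RealScalars => fun x => x | ComplexScalars => @complex.Re R end.

Definition real_scalar (R : realType) (k : scalar_kind) :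
    R -> scalar_field R k :=
  match k with RealScalars => fun x => x | ComplexScalars => real_complex R end.
Arguments real_scalar {R k}.

Section scalar_lemmas.
Variables (R : realType) (k : scalar_kind).
Local Notation K := (scalar_field R k).
Implicit Types (x y : K) (a b : R).

Lemma real_scalarK a : scalar_re (real_scalar a : K) = a.
Proof. by case: k. Qed.

Lemma ler_real_scalar a b : (real_scalar a <= real_scalar b :> K) = (a <= b).
Proof. by case: k => //=; rewrite lecR. Qed.

Lemma real_scalar0 : real_scalar 0 = 0 :> K.
Proof. by case: k. Qed.

Lemma real_scalarD a b :
  real_scalar (a + b) = real_scalar a + real_scalar b :> K.
Proof. by case: k => //=; rewrite rmorphD. Qed.

Lemma real_scalarM a b :
  real_scalar (a * b) = real_scalar a * real_scalar b :> K.
Proof. by case: k => //=; rewrite rmorphM. Qed.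

Lemma scalar_reK x : 0 <= x -> real_scalar (scalar_re x) = x.
Proof.
case: k x => //= -[a b]; rewrite lecE /= => /andP[/eqP b0 _].
by congr Complex.
Qed.

Lemma scalar_re_le x y : x <= y -> scalar_re x <= scalar_re y.
Proof. by case: k x y => //= -[a b] [c d]; rewrite lecE => /andP[]. Qed.

End scalar_lemmas.

Section dual.
Variables (R : realType) (k : scalar_kind).
Local Notation K := (scalar_field R k).
Variable X : normedModType K.

Definition continuous_linear : {pred X -> K^o} :=
  fun f => `[< linear f /\ continuous f >].

Lemma continuous_linear_submod : GRing.subsemimod_closed continuous_linear.
Proof.
split=> [|a f]; first split.
- apply/asboolP; split; first by move=> a u v /=; rewrite scaler0 addr0.
  by move=> x; exact: cst_continuous.
- move=> f g /asboolP[lf cf] /asboolP[lg cg]; apply/asboolP; split.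
    by move=> a u v /=; rewrite !fctE lf lg scalerDr addrACA.
  by move=> x; apply: cvgD; [exact: cf | exact: cg].
- move=> /asboolP[lf cf]; apply/asboolP; split.
    by move=> b u v /=; rewrite !fctE lf scalerDr !scalerA mulrC.
  by move=> x; apply: cvgZl_tmp; exact: cf.
Qed.

HB.instance Definition _ := GRing.isSubmodClosed.Build K (X -> K^o)
  continuous_linear continuous_linear_submod.

Record dual := Dual {
  dual_fun :> X -> K^o;
  _ : dual_fun \in continuous_linear }.

HB.instance Definition _ := [isSub for dual_fun].
HB.instance Definition _ := [Choice of dual by <:].
HB.instance Definition _ := [SubChoice_isSubLmodule of dual by <:].

End dual.

HB.instance Definition _ (R : realType) (k : scalar_kind)
    (X : normedModType (scalar_field R k)) (f : dual X) :=
  GRing.isLinear.Build (scalar_field R k) X (scalar_field R k)^o _ (dual_fun f)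
    (asboolP _ (valP f)).1.

Section dual_norm.
Variables (R : realType) (k : scalar_kind).
Local Notation K := (scalar_field R k).
Variable X : normedModType K.
Implicit Types (f g : dual X) (x : X).

Lemma dual_continuous f : continuous f.
Proof. exact: (asboolP _ (valP f)).2. Qed.

Definition ball_values f : set R :=
  [set scalar_re `|f x| | x in [set x | `|x| <= 1]].

Definition dual_norm f : K := real_scalar (sup (ball_values f)).

Lemma ball_values_has_sup f : has_sup (ball_values f).
Proof.
split; first by exists (scalar_re `|f 0|), 0 => //=; rewrite normr0 ler01.
have /linear_bounded_continuous/linear_boundedP := @dual_continuous f.
move=> /pinfty_ex_gt0[M M0 fM]; exists (scalar_re M) => _ [x /= x1 <-].
by apply: scalar_re_le; rewrite (le_trans (fM x))// ler_piMr// ltW.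
Qed.

Lemma dual_norm_ge0 f : 0 <= dual_norm f.
Proof.
rewrite /dual_norm -real_scalar0 ler_real_scalar.
apply: ub_le_sup; first by case: (ball_values_has_sup f).
exists 0; first by rewrite /= normr0 ler01.
by rewrite linear0 normr0 -real_scalar0 real_scalarK.
Qed.

Lemma ler_dual f x : `|f x| <= dual_norm f * `|x|.
Proof.
have [->|x0] := eqVneq x 0; first by rewrite linear0 !normr0 mulr0.
rewrite -ler_pdivrMr ?normr_gt0// -[leLHS]scalar_reK; last exact: divr_ge0.
rewrite ler_real_scalar; apply: ub_le_sup.
  by case: (ball_values_has_sup f).
exists (`|x|^-1 *: x) => /=.
  by rewrite normrZ normfV normr_id mulVf// normr_eq0.
by rewrite linearZ/= normrZ normfV normr_id mulrC.
Qed.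

Lemma dual_norm_le f (M : K) : 0 <= M ->
  (forall x, `|f x| <= M * `|x|) -> dual_norm f <= M.
Proof.
move=> M0 fM; rewrite -(scalar_reK M0) ler_real_scalar; apply: ge_sup.
  by case: (ball_values_has_sup f).
move=> _ [x /= x1 <-]; apply: scalar_re_le.
by rewrite (le_trans (fM x))// ler_piMr.
Qed.

Lemma dual_normD f g : dual_norm (f + g) <= dual_norm f + dual_norm g.
Proof.
apply: dual_norm_le => [|x]; first by rewrite addr_ge0// dual_norm_ge0.
by rewrite mulrDl (le_trans (ler_normD _ _))// lerD// ler_dual.
Qed.

Lemma dual_normZ (a : K) f : dual_norm (a *: f) = `|a| * dual_norm f.
Proof.
have le b h : dual_norm (b *: h) <= `|b| * dual_norm h.
  apply: dual_norm_le => [|x]; first by rewrite mulr_ge0// dual_norm_ge0.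
  by rewrite -mulrA -[leLHS]/(`|b * h x|) normrM ler_wpM2l// ler_dual.
apply/eqP; rewrite eq_le le/=.
have [->|a0] := eqVneq a 0; first by rewrite normr0 mul0r dual_norm_ge0.
rewrite -ler_pdivlMl ?normr_gt0// -normfV.
by rewrite -{1}[f](@scalerK _ _ _ a0) le.
Qed.

Lemma dual_norm_eq0 f : dual_norm f = 0 -> f = 0.
Proof.
move=> f0; apply/val_inj/funext => x; apply/eqP; rewrite -normr_le0.
by rewrite (le_trans (ler_dual f x))// f0 mul0r.
Qed.

HB.instance Definition _ := Lmodule_isNormed.Build K (dual X)
  dual_normD dual_normZ dual_norm_eq0.

End dual_norm.

Section bidual.
Variables (R : realType) (k : scalar_kind).
Local Notation K := (scalar_field R k).
Variable X : normedModType K.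

Definition evaluation (x : X) : dual X -> K^o := fun f => f x.

Lemma evaluation_linear (x : X) : linear (evaluation x).
Proof. by []. Qed.

HB.instance Definition _ (x : X) :=
  GRing.isLinear.Build K (dual X) K^o _ (evaluation x) (evaluation_linear x).

Lemma evaluation_continuous_linear (x : X) :
  evaluation x \in @continuous_linear R k (dual X).
Proof.
apply/asboolP; split; first exact: evaluation_linear.
apply/linear_bounded_continuous/linear_boundedP.
exists `|x|; split=> [|r xr f]; first exact: normr_real.
rewrite (le_trans (ler_dual f x))// mulrC ler_wpM2r//; last exact: ltW.
exact: (dual_norm_ge0 f).
Qed.

Definition to_bidual (x : X) : dual (dual X) :=
  Dual (evaluation_continuous_linear x).

Lemma to_bidual_linear : linear to_bidual.
Proof.
by move=> a x y; apply/val_inj/funext => f /=; rewrite /evaluation linearP.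
Qed.

HB.instance Definition _ :=
  GRing.isLinear.Build K X (dual (dual X)) _ to_bidual to_bidual_linear.

End bidual.

Section linear_subspace.
Variables (R : realType) (k : scalar_kind).
Local Notation K := (scalar_field R k).
Variables (X : normedModType K) (Y : submodClosed X).

Definition subspace_of := {x : X | x \in Y}.

HB.instance Definition _ := SubChoice.on subspace_of.
HB.instance Definition _ := [SubChoice_isSubLmodule of subspace_of by <:].

Let norm_sub (y : subspace_of) : K := `|val y|.

Let norm_subD (y z : subspace_of) : norm_sub (y + z) <= norm_sub y + norm_sub z.
Proof. exact: ler_normD. Qed.

Let norm_subZ (a : K) (y : subspace_of) : norm_sub (a *: y) = `|a| * norm_sub y.
Proof. exact: normrZ. Qed.

Let norm_sub_eq0 (y : subspace_of) : norm_sub y = 0 -> y = 0.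
Proof. by move=> /normr0_eq0 y0; exact: val_inj. Qed.

HB.instance Definition _ := Lmodule_isNormed.Build K subspace_of
  norm_subD norm_subZ norm_sub_eq0.

End linear_subspace.

(* A subspace is given together with its inclusion j, so that X can be regarded
   as a subspace of its bidual through to_bidual. *)
Definition property_U (R : realType) (k : scalar_kind)
    (X Z : normedModType (scalar_field R k)) (j : {linear X -> Z}) : Prop :=
  forall f : dual X,
    exists! g : dual Z, (forall x, g (j x) = f x) /\ `|g| = `|f|.

Definition totally_smooth (R : realType) (k : scalar_kind)
    (X Z : normedModType (scalar_field R k)) (j : {linear X -> Z}) : Prop :=
  forall Y : submodClosed X, closed [set x | x \in Y] ->
    property_U (j \o (val : subspace_of Y -> X)).

Definition smooth (R : realType) (k : scalar_kind)
    (X : normedModType (scalar_field R k)) : Prop :=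
  forall x : X, `|x| = 1 -> exists! f : dual X, `|f| = 1 /\ f x = 1.

Definition support_map (R : realType) (k : scalar_kind)
    (X : normedModType (scalar_field R k)) (x : X) : dual X :=
  xget 0 [set f : dual X | `|f| = 1 /\ f x = 1].

Definition weak (R : realType) (k : scalar_kind)
    (X : normedModType (scalar_field R k)) : topologicalType :=
  let K : topologicalType := scalar_field R k in
  initial_topology ((fun x f => f x) : X -> {ptws dual X -> K}).

Definition very_smooth (R : realType) (k : scalar_kind)
    (X : normedModType (scalar_field R k)) : Prop :=
  smooth X /\
  {within [set x : X | `|x| = 1],
    continuous (@support_map R k X : X -> weak (dual X))}.

Definition separable_space (T : topologicalType) : Prop :=
  exists2 D : set T, countable D & dense D.

Record norm_on (K : numFieldType) (V : lmodType K) := NormOn {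
  norm_fun :> V -> K;
  norm_onD : forall x y, norm_fun (x + y) <= norm_fun x + norm_fun y;
  norm_onZ : forall a x, norm_fun (a *: x) = `|a| * norm_fun x;
  norm_on_eq0 : forall x, norm_fun x = 0 -> x = 0 }.

Definition equivalent_norm (K : numFieldType) (X : normedModType K)
    (N : norm_on X) : Prop :=
  exists a b : K, [/\ 0 < a, 0 < b &
    forall x : X, a * `|x| <= N x /\ N x <= b * `|x|].

Definition with_norm (K : numFieldType) (V : lmodType K) (N : norm_on V) : Type
  := V.

HB.instance Definition _ (K : numFieldType) (V : lmodType K) (N : norm_on V) :=
  GRing.Lmodule.on (with_norm N).
HB.instance Definition _ (K : numFieldType) (V : lmodType K) (N : norm_on V) :=
  Lmodule_isNormed.Build K (with_norm N)
    (@norm_onD K V N) (@norm_onZ K V N) (@norm_on_eq0 K V N).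

(* Main.v *)
Require Import Defs.
From HB Require Import structures.
From mathcomp Require Import all_boot all_order all_algebra complex ring lra.
From mathcomp Require Import all_classical all_reals all_analysis.

Set Implicit Arguments.
Unset Strict Implicit.
Unset Printing Implicit Defensive.
Import Order.TTheory GRing.Theory Num.Theory.
Import numFieldNormedType.Exports.
Local Open Scope classical_set_scope.
Local Open Scope ring_scope.

(** Why the theorem holds.

    Fix a sequence y_i spanning a dense subspace of X, with the norm of y_i at
    most 2^-(i+1), let C be the set of its finite combinations with
    coefficients in the unit ball of l^2, and put, for f in X^*,
      h(f) = sup of |f| over C = (sum_i |f(y_i)|^2)^(1/2),
      q(f) = ||f|| + h(f).
    Then q is an equivalent norm on X^*, and being a supremum of values
    |f(z + s)| with z in the unit ball of X and s in C, it is the dual norm of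
    an equivalent norm N on X (rnorm_dual_predual). Two facts about N carry
    the proof.

    First, the dual norm q is strictly convex (rotund_augmented): if
    q(f + g) = q(f) + q(g), then h(f + g) = h(f) + h(g), and the parallelogram
    law for h makes f and g positively proportional.

    Second, property U in the bidual passes from the given norm to N
    (predual_property_U). Let F on the bidual extend f and have N-norm q(f).
    Since C lies in X itself, Phi + s has N-bidual norm at most 1 whenever Phi
    is in the original unit ball of X^** and s is in C. Hence
    ||F|| + h(f) <= q(f) = ||f|| + h(f): so F has original norm ||f||, and it
    is the unique such extension of f for the original norm.

    These two facts suffice for both conclusions. For total smoothness
    (totally_smooth_bidual), a norm-preserving extension of a functional from
    a subspace Y to X^** restricts to a norm-preserving extension to X, which
    is unique by strict convexity of the dual, and property U then determines
    it on X^**. For very smoothness (very_smooth_bidual), the limit of support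
    functionals f_y along an ultrafilter converging to x defines a functional
    on X^**; its restriction to X supports x, so it is f_x by smoothness, and
    property U identifies the limit with evaluation at f_x. *)

(** * Scalars and real-valued norms *)

Section scalars.
Variables (R : realType) (k : scalar_kind).
Local Notation K := (scalar_field R k).
Implicit Types (z w : K) (r : R).

Lemma scalar_reD z w : scalar_re (z + w) = scalar_re z + scalar_re w.
Proof. by case: k z w => //= -[a b] [c d]. Qed.

Lemma scalar_re_realM r z : scalar_re (real_scalar r * z) = r * scalar_re z.
Proof. by case: k z => //= -[a b] /=; rewrite mul0r subr0. Qed.

Lemma scalar_re0 : scalar_re (0 : K) = 0.
Proof. by case: k. Qed.

Lemma ltr_real_scalar r r' : (real_scalar r < real_scalar r' :> K) = (r < r').
Proof. by case: k => //=; rewrite ltcR. Qed.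

Lemma real_scalar1 : real_scalar 1 = 1 :> K.
Proof. by case: k. Qed.

Lemma scalar_reN z : scalar_re (- z) = - scalar_re z.
Proof. by case: k z => //= -[a b]. Qed.

Lemma normr_real_scalar r : `|real_scalar r : K| = real_scalar `|r|.
Proof. by case: k => //=; rewrite normc_def /= expr0n addr0 sqrtr_sqr. Qed.

Lemma scalar_re_le_norm z : `|scalar_re z| <= scalar_re `|z|.
Proof.
case: k z => //= -[a b] /=; rewrite -sqrtr_sqr ler_wsqrtr//.
by rewrite lerDl sqr_ge0.
Qed.

Lemma scalar_eq_re z : scalar_re `|z| <= scalar_re z -> z = `|z|.
Proof.
case: k z => /= [z|[a b]] /=.
  by move=> zz; apply/eqP; rewrite eq_le ler_norm.
move=> h; have a0 : 0 <= a by rewrite (le_trans _ h)// sqrtr_ge0.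
move: h; rewrite -{2}(ger0_norm a0) -sqrtr_sqr ler_sqrt;
  last by rewrite sqr_ge0.
rewrite gerDl => b0; have /eqP : b ^+ 2 = 0.
  by apply/eqP; rewrite eq_le b0 sqr_ge0.
rewrite sqrf_eq0 => /eqP ->.
by rewrite normc_def /= expr0n addr0 sqrtr_sqr ger0_norm.
Qed.

Lemma scalar_parallelogram z w :
  scalar_re `|z + w| ^+ 2 + scalar_re `|z - w| ^+ 2 =
  scalar_re `|z| ^+ 2 *+ 2 + scalar_re `|w| ^+ 2 *+ 2.
Proof.
case: k z w => /= [z w|[a b] [c d]] /=.
  by rewrite !real_normK ?num_real//; ring.
by rewrite !sqr_sqrtr ?addr_ge0 ?sqr_ge0//; ring.
Qed.

(** The constant c is the imaginary unit for complex scalars, so that a scalar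
    is controlled by the real parts of two of its multiples; this reduces
    convergence of scalars to convergence of real parts. *)
Lemma scalar_norm_le_re2 :
  exists c : K, forall z,
    scalar_re `|z| <= `|scalar_re z| + `|scalar_re (c * z)|.
Proof.
case: k => /=; first by exists 0 => z; rewrite lerDl.
exists (Complex 0 1) => -[a b] /=; rewrite mul0r mul1r sub0r normrN.
rewrite -[leRHS]ger0_norm ?addr_ge0// -sqrtr_sqr ler_wsqrtr//.
rewrite sqrrD !real_normK ?num_real// -!addrA lerD2l.
by rewrite addrA lerDr addr_ge0 ?mulr_ge0.
Qed.

End scalars.

(** The real number underlying a norm: inequalities between norms become
    inequalities in an ordered field. *)
Definition rnorm (R : realType) (k : scalar_kind)
  (V : normedModType (scalar_field R k)) (x : V) : R := scalar_re `|x|.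

Section rnorm.
Variables (R : realType) (k : scalar_kind).
Local Notation K := (scalar_field R k).
Variable V : normedModType K.
Implicit Types (x y : V) (a : K) (r : R).

Lemma rnormE x : `|x| = real_scalar (rnorm x).
Proof. by rewrite scalar_reK. Qed.

Lemma rnorm_ge0 x : 0 <= rnorm x.
Proof. by rewrite -(@ler_real_scalar R k) -rnormE real_scalar0. Qed.

Lemma rnormD x y : rnorm (x + y) <= rnorm x + rnorm y.
Proof. by rewrite -(@ler_real_scalar R k) real_scalarD -!rnormE ler_normD. Qed.

Lemma rnorm0 : rnorm (0 : V) = 0.
Proof. by rewrite /rnorm normr0 scalar_re0. Qed.

Lemma rnorm0_eq0 x : rnorm x = 0 -> x = 0.
Proof. by move=> x0; apply/normr0_eq0; rewrite rnormE x0 real_scalar0. Qed.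

Lemma rnormZ a x : rnorm (a *: x) = rnorm (a : K^o) * rnorm x.
Proof.
by rewrite {1}/rnorm normrZ rnormE mulrC scalar_re_realM mulrC.
Qed.

Lemma rnorm_real_scalar r : rnorm (real_scalar r : K^o) = `|r|.
Proof. by rewrite /rnorm normr_real_scalar real_scalarK. Qed.

Lemma rnormZr r x : 0 <= r -> rnorm (real_scalar r *: x) = r * rnorm x.
Proof. by move=> r0; rewrite rnormZ rnorm_real_scalar ger0_norm. Qed.

End rnorm.

Section phase.
Variables (R : realType) (k : scalar_kind).
Local Notation K := (scalar_field R k).

Lemma phase_rotation (z : K^o) :
  exists2 t : K^o, rnorm t <= 1 & t * z = real_scalar (rnorm z).
Proof.
have [->|z0] := eqVneq z 0.
  by exists 0; rewrite ?mul0r rnorm0 ?real_scalar0.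
exists (`|z| / z); last by rewrite mulfVK// rnormE.
by rewrite /rnorm normrM normfV normr_id divff ?normr_eq0// -real_scalar1
  real_scalarK.
Qed.
End phase.

Section dual_rnorm.
Variables (R : realType) (k : scalar_kind).
Local Notation K := (scalar_field R k).
Variable V : normedModType K.
Implicit Types (f g : dual V) (x : V) (M : R).

Definition re_of f x : R := scalar_re (f x).

Lemma re_ofD f x y : re_of f (x + y) = re_of f x + re_of f y.
Proof. by rewrite /re_of linearD scalar_reD. Qed.

Lemma re_ofN f x : re_of f (- x) = - re_of f x.
Proof. by rewrite /re_of linearN scalar_reN. Qed.

Lemma re_ofZ f r x : re_of f (real_scalar r *: x) = r * re_of f x.
Proof. by rewrite /re_of linearZ/= -scalar_re_realM. Qed.

Lemma rnorm_dual f x : rnorm (f x) <= rnorm f * rnorm x.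
Proof.
by rewrite -(@ler_real_scalar R k) real_scalarM -!rnormE; exact: ler_dual.
Qed.

Lemma re_of_le f x : re_of f x <= rnorm f * rnorm x.
Proof.
by rewrite (le_trans _ (rnorm_dual f x))// (le_trans (ler_norm _))//
  scalar_re_le_norm.
Qed.

Lemma re_of_rotate f x :
  exists2 t : K^o, rnorm t <= 1 & re_of f (t *: x) = rnorm (f x).
Proof.
have [t t1 tx] := phase_rotation (f x); exists t => //.
by rewrite /re_of linearZ/= [_ *: _]tx real_scalarK.
Qed.

(** Rotating x makes f x a nonnegative real, so real parts already determine
    the dual norm. *)
Lemma rnorm_dual_le f M :
  (forall x, rnorm x <= 1 -> re_of f x <= M) -> rnorm f <= M.
Proof.
move=> fM; rewrite -(@ler_real_scalar R k) -rnormE ler_real_scalar.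
apply: ge_sup; first by case: (ball_values_has_sup f).
move=> _ [x /= x1 <-]; rewrite -/(rnorm (f x)).
have [t t1 <-] := re_of_rotate f x; apply: fM.
rewrite rnormZ mulr_ile1 ?rnorm_ge0//.
by rewrite -(@ler_real_scalar R k) -rnormE real_scalar1.
Qed.

Lemma re_of_inj f g : re_of f =1 re_of g -> f = g.
Proof.
move=> fg; apply/eqP; rewrite -subr_eq0; apply/eqP.
apply: rnorm0_eq0; apply/eqP; rewrite eq_le rnorm_ge0 andbT.
apply: rnorm_dual_le => x _.
by rewrite /re_of /= scalar_reD scalar_reN -![scalar_re (_ x)]/(re_of _ x) fg
  subrr.
Qed.

End dual_rnorm.

(** * The Hahn-Banach theorem *)

Section hahn_banach_real.
Variables (R : realType) (V : lmodType R) (p : V -> R).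
Hypothesis p_sub : forall x y, p (x + y) <= p x + p y.
Hypothesis p_pos : forall r x, 0 < r -> p (r *: x) = r * p x.

(** A linear functional on a subspace is encoded by its graph. Single-valuedness
    need not be required: it follows from domination by p. *)
Definition dominated_graph (G : set (V * R)) : Prop :=
  [/\ G !=set0, forall a z w, G z -> G w -> G (a *: z.1 + w.1, a * z.2 + w.2)
    & forall z, G z -> z.2 <= p z.1].

Lemma dominated_graph0 G : dominated_graph G -> G (0, 0).
Proof.
move=> [[z Gz] GL _]; have := GL (-1) _ _ Gz Gz.
by rewrite scaleN1r addNr mulN1r addNr.
Qed.

Lemma dominated_graphZ G a z :
  dominated_graph G -> G z -> G (a *: z.1, a * z.2).
Proof.
move=> GG Gz; have [_ GL _] := GG.
by have := GL a _ _ Gz (dominated_graph0 GG); rewrite /= !addr0.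
Qed.

(** A pair (0, r) in the graph has r <= p 0 = 0, and likewise - r <= 0. *)
Lemma dominated_graph_fun G x r s :
  dominated_graph G -> G (x, r) -> G (x, s) -> r = s.
Proof.
move=> GG Gr Gs; have [_ GL Gp] := GG.
have p0 : p 0 = 0.
  by have := @p_pos 2 0 (ltr0n _ 2); rewrite scaler0 => h; lra.
have := Gp _ (GL (-1) _ _ Gr Gs); have := Gp _ (GL (-1) _ _ Gs Gr).
by rewrite /= scaleN1r addNr p0 !mulN1r => h1 h2; lra.
Qed.

(** The value c at the new vector x0 must lie between the numbers
    r - p (w - x0) and p (z + x0) - s for (w, r) and (z, s) in the graph; by
    subadditivity every one of the former is below every one of the latter. *)
Lemma dominated_graph_extend G x0 : dominated_graph G ->
  exists c, dominated_graph
    [set z | exists w t, G w /\ z = (w.1 + t *: x0, w.2 + t * c)].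
Proof.
move=> GG; have [_ GL Gp] := GG; have G0 := dominated_graph0 GG.
have sep w z : G w -> G z -> w.2 - p (w.1 - x0) <= p (z.1 + x0) - z.2.
  move=> Gw Gz; have := Gp _ (GL 1 _ _ Gw Gz).
  rewrite /= scale1r mul1r => h.
  have := p_sub (w.1 - x0) (z.1 + x0).
  by rewrite addrCA subrK addrC => h'; lra.
pose A := [set w.2 - p (w.1 - x0) | w in G].
have supA : has_sup A.
  split; first by exists (0 - p (0 - x0)), (0, 0).
  by exists (p (0 + x0) - 0) => _ [w Gw <-]; exact: (sep _ (0, 0)).
exists (sup A); have Asup w : G w -> w.2 - p (w.1 - x0) <= sup A.
  by move=> Gw; apply: ub_le_sup; [case: supA|exists w].
have supAp z : G z -> sup A <= p (z.1 + x0) - z.2.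
  move=> Gz; apply: ge_sup; first by case: supA.
  by move=> _ [w Gw <-]; exact: sep.
split.
- by exists (0 + 0 *: x0, 0 + 0 * sup A), (0, 0), 0.
- move=> a _ _ [w [t [Gw ->]]] [w' [t' [Gw' ->]]] /=.
  exists (a *: w.1 + w'.1, a * w.2 + w'.2), (a * t + t'); split.
    exact: GL.
  congr pair => /=; last by ring.
  by rewrite scalerDr scalerDl scalerA addrACA.
- move=> _ [w [t [Gw ->]]] /=.
  have [t0|t0|->] := ltgtP t 0; last by rewrite scale0r mul0r !addr0 Gp.
  + have nt0 : 0 < - t by lra.
    have := Asup _ (dominated_graphZ (- t)^-1 GG Gw); rewrite /=.
    rewrite -(ler_pM2l nt0) mulrBr mulrA mulfV ?gt_eqF// mul1r -p_pos//.
    rewrite scalerBr scalerA mulfV ?gt_eqF// scale1r scaleNr opprK => h; lra.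
  + have := supAp _ (dominated_graphZ t^-1 GG Gw); rewrite /=.
    rewrite -(ler_pM2l t0) mulrBr mulrA mulfV ?gt_eqF// mul1r -p_pos//.
    rewrite scalerDr scalerA mulfV ?gt_eqF// scale1r => h; lra.
Qed.

Lemma hahn_banach (G0 : set (V * R)) : dominated_graph G0 ->
  exists u : V -> R, [/\ forall a x y, u (a *: x + y) = a * u x + u y,
    forall x, u x <= p x & forall z, G0 z -> u z.1 = z.2].
Proof.
move=> GG0; have [[z0 G0z0] _ _] := GG0.
(* Zorn is applied to sets A for which the union of G0 and A is a dominated
   graph, so that the empty chain also has an upper bound. *)
have [|A [PA maxA]] := @Zorn_bigcup _ (fun A => dominated_graph (G0 `|` A)).
  move=> F FP Ftot; split; first by exists z0; left.
  - have wit z : (G0 `|` \bigcup_(A in F) A) z ->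
        G0 z \/ exists2 A, F A & (G0 `|` A) z.
      by move=> [|[A FA Az]]; [left | right; exists A => //; right].
    have up A : F A -> G0 `|` A `<=` G0 `|` \bigcup_(A in F) A.
      by move=> FA z [?|Az]; [left | right; exists A].
    move=> a z w /wit[Gz|[A FA Az]] /wit[Gw|[B FB Bw]].
    + by left; case: GG0 => _ + _; apply.
    + by apply: (up B FB); case: (FP _ FB) => _ + _; apply => //; left.
    + by apply: (up A FA); case: (FP _ FA) => _ + _; apply => //; left.
    + have [AB|BA] := Ftot _ _ FA FB.
        apply: (up B FB); case: (FP _ FB) => _ + _; apply => //.
        by case: Az; [left | right; exact: AB].
      apply: (up A FA); case: (FP _ FA) => _ + _; apply => //.
      by case: Bw; [left | right; exact: BA].
  - move=> z [Gz|[A FA Az]]; first by case: GG0 => _ _; apply.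
    by case: (FP _ FA) => _ _; apply; right.
set G := G0 `|` A in PA maxA; have [_ GL Gp] := PA.
have total x : exists r, G (x, r).
  have [c Gc] := dominated_graph_extend x PA.
  set G' := (X in dominated_graph X) in Gc.
  have GG' : G `<=` G'.
    by move=> z Gz; exists z, 0; split=> //;
      rewrite scale0r mul0r !addr0 -surjective_pairing.
  have xG' : G' (x, c).
    exists (0, 0), 1; split; first exact: dominated_graph0.
    by rewrite scale1r mul1r !add0r.
  have [AG'|AG'] := pselect (G' `<=` A); first by exists c; right; exact: AG'.
  exfalso; apply: (maxA G').
    split; last by move=> /AG'.
    by move=> z Az; apply: GG'; right.
  rewrite (_ : _ `|` _ = G')//; apply/seteqP; split => [z [Gz|//]|z];
    last by right.
  by apply: GG'; left.
pose u x := xget 0 [set r | G (x, r)].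
have Gu x : G (x, u x).
  by exact: (@xgetPex _ 0 [set r | G (x, r)] (total x)).
exists u; split.
- move=> a x y; apply: (dominated_graph_fun PA (Gu _)).
  exact: (GL a _ _ (Gu x) (Gu y)).
- by move=> x; exact: (Gp _ (Gu x)).
- move=> [x r] G0x; apply: (dominated_graph_fun PA (Gu _)).
  by left.
Qed.

End hahn_banach_real.

Section build.
Variables (R : realType) (k : scalar_kind).
Local Notation K := (scalar_field R k).

Lemma bounded_linear_dual (V : normedModType K) (F : V -> K^o) (M : R) :
  linear F -> (forall x, rnorm (F x) <= M * rnorm x) ->
  exists f : dual V, dual_fun f = F.
Proof.
move=> linF FM.
pose L : {linear V -> K^o} :=
  HB.pack F (GRing.isLinear.Build K V K^o _ F linF).
suff FP : F \in @continuous_linear R k V by exists (Dual FP).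
apply/asboolP; split=> //.
apply/(linear_bounded_continuous L)/linear_boundedP.
exists (real_scalar `|M|); split=> [|r Mr x].
  by rewrite ger0_real// -real_scalar0 ler_real_scalar.
rewrite (@le_trans _ _ (real_scalar `|M| * `|x|))//; last first.
  by rewrite ler_wpM2r// ltW.
rewrite !rnormE -real_scalarM ler_real_scalar (le_trans (FM x))//.
by rewrite ler_wpM2r ?rnorm_ge0// ler_norm.
Qed.

(** For complex scalars the functional with real part u is
    x |-> u x - i u (i x). *)
Lemma linear_re_part (V : normedModType K) (u : V -> R) :
  (forall x y, u (x + y) = u x + u y) ->
  (forall r x, u (real_scalar r *: x) = r * u x) ->
  exists2 F : V -> K^o, linear F & forall x, scalar_re (F x) = u x.
Proof.
case: k V u => /= V u uD uZ.
  by exists u => // a x y; rewrite uD uZ.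
pose i : R[i] := Complex 0 1.
exists (fun x => Complex (u x) (- u (i *: x))) => // -[a b] x y.
have split_ab (z : V) : Complex a b *: z = (a%:C)%C *: z + (b%:C)%C *: (i *: z).
  rewrite scalerA -scalerDl; congr (_ *: _).
  by apply/eqP; rewrite eq_complex /=; apply/andP; split; apply/eqP; ring.
have ii : i *: (i *: x) = - x.
  rewrite scalerA -scaleN1r; congr (_ *: _).
  by apply/eqP; rewrite eq_complex /=; apply/andP; split; apply/eqP; ring.
have uN z : u (- z) = - u z.
  by have := uZ (-1) z; rewrite mulN1r => <-; rewrite rmorphN1 scaleN1r.
apply/eqP; rewrite eq_complex /=; apply/andP; split; apply/eqP.
  by rewrite uD split_ab uD !uZ; ring.
rewrite scalerDr uD split_ab scalerDr uD !(scalerA i) !(mulrC i) -!scalerA.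
by rewrite !uZ ii uN; ring.
Qed.

Lemma real_functional_dual (V : normedModType K) (u : V -> R) (M : R) :
  0 <= M -> (forall x y, u (x + y) = u x + u y) ->
  (forall r x, u (real_scalar r *: x) = r * u x) ->
  (forall x, u x <= M * rnorm x) ->
  exists2 f : dual V, re_of f =1 u & rnorm f <= M.
Proof.
move=> M0 uD uZ uM; have [F linF Fu] := linear_re_part uD uZ.
have [|f fF] := @bounded_linear_dual V F M linF.
  move=> x; have [t t1 tx] := phase_rotation (F x).
  have <- : u (t *: x) = rnorm (F x).
    rewrite -Fu -[RHS](@real_scalarK R k) -tx.
    by have := linF t x 0; rewrite !addr0 => ->;
      have := linF (-1) 0 0; rewrite scaler0 addr0 scaleN1r addNr => ->;
      rewrite addr0.
  rewrite (le_trans (uM _))// ler_wpM2l// rnormZ ler_piMl ?rnorm_ge0//.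
have fu : re_of f =1 u by move=> x; rewrite /re_of fF.
exists f => //; apply: rnorm_dual_le => x x1.
by rewrite fu (le_trans (uM x))// ler_piMr.
Qed.

(** V as a real vector space. *)
Definition restrict_scalars (V : normedModType K) : Type := V.

Section restrict_scalars.
Variable V : normedModType K.
HB.instance Definition _ := GRing.Zmodule.on (restrict_scalars V).

Let scale (r : R) (x : restrict_scalars V) : restrict_scalars V :=
  (real_scalar r : K) *: (x : V).

Let scaleA a b x : scale a (scale b x) = scale (a * b) x.
Proof. by rewrite /scale scalerA real_scalarM. Qed.
Let scale1 : left_id 1 scale.
Proof. by move=> x; rewrite /scale real_scalar1 scale1r. Qed.
Let scaleDr : right_distributive scale +%R.
Proof. by move=> a x y; rewrite /scale scalerDr. Qed.
Let scaleDl x : {morph scale^~ x : a b / a + b}.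
Proof. by move=> a b; rewrite /scale real_scalarD scalerDl. Qed.

HB.instance Definition _ := GRing.Zmodule_isLmodule.Build R (restrict_scalars V)
  scaleA scale1 scaleDr scaleDl.
End restrict_scalars.

(** The data to extend are real: a real-linear graph prescribes only real
    parts, and the extension is complexified without increasing its bound. *)
Lemma hahn_banach_dual (V : normedModType K) (M : R) (G : set (V * R)) :
  0 <= M -> G (0, 0) ->
  (forall a z w, G z -> G w -> G (real_scalar a *: z.1 + w.1, a * z.2 + w.2)) ->
  (forall z, G z -> z.2 <= M * rnorm z.1) ->
  exists2 f : dual V, rnorm f <= M & forall z, G z -> re_of f z.1 = z.2.
Proof.
move=> M0 G0 GL GM.
have [| |//|u [uL uM uG]] := @hahn_banach R (restrict_scalars V)
    (fun x => M * rnorm (x : V)) _ _ G.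
- by move=> x y; rewrite -mulrDr ler_wpM2l// rnormD.
- by move=> r x r0; rewrite (@rnormZr R k V r x (ltW r0)) mulrCA.
- by split=> //; exists (0, 0).
have uD x y : u (x + y) = u x + u y.
  by have := uL 1 x y; rewrite scale1r mul1r.
have u0 : u 0 = 0 by have := uD 0 0; rewrite addr0 => h; lra.
have uZ r x : u ((real_scalar r : K) *: (x : V)) = r * u x.
  by have := uL r x 0; rewrite !addr0 u0 addr0.
have [f fu fM] := @real_functional_dual V u M M0 uD uZ uM.
by exists f => // z Gz; rewrite fu uG.
Qed.

Lemma norming_functional (V : normedModType K) (x : V) :
  exists2 f : dual V, rnorm f <= 1 & f x = real_scalar (rnorm x).
Proof.
have [|||| f f1 fG] := @hahn_banach_dual V 1
  [set z | exists t : R, z = (real_scalar t *: x, t * rnorm x)].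
- by [].
- by exists 0; rewrite real_scalar0 scale0r mul0r.
- move=> a _ _ [s ->] [t ->] /=; exists (a * s + t).
  by rewrite scalerA -real_scalarM -scalerDl -real_scalarD mulrA -mulrDl.
- move=> _ [t ->] /=; rewrite mul1r rnormZ rnorm_real_scalar.
  by rewrite ler_wpM2r ?rnorm_ge0// ler_norm.
exists f => //.
have fx : re_of f x = rnorm x.
  have := fG (real_scalar 1 *: x, 1 * rnorm x).
  by rewrite /= real_scalar1 scale1r mul1r; apply; exists 1;
    rewrite real_scalar1 scale1r mul1r.
have fxx : rnorm (f x) <= rnorm x.
  by rewrite (le_trans (rnorm_dual f x))// ler_piMl ?rnorm_ge0.
have := @scalar_eq_re R k (f x).
rewrite -[scalar_re (f x)]/(re_of f x) fx => /(_ fxx) ->.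
rewrite rnormE; congr real_scalar; apply/eqP; rewrite eq_le fxx -fx.
by rewrite (le_trans (ler_norm _))// scalar_re_le_norm.
Qed.

Lemma hahn_banach_subspace (V : normedModType K) (Y : submodClosed V)
    (f : dual (subspace_of Y)) :
  exists2 g : dual V, rnorm g <= rnorm f & forall y, g (val y) = f y.
Proof.
have [|||| g gf gG] := @hahn_banach_dual V (rnorm f)
  [set z | exists y : subspace_of Y, z = (val y, re_of f y)].
- exact: rnorm_ge0.
- by exists 0; rewrite /re_of !linear0 scalar_re0.
- move=> a _ _ [y ->] [z ->] /=; exists (real_scalar a *: y + z).
  by rewrite re_ofD re_ofZ.
- by move=> _ [y ->] /=; exact: re_of_le.
exists g => // y.
apply/eqP; rewrite -subr_eq0; apply/eqP; apply: rnorm0_eq0.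
have [t t1 tE] := phase_rotation (g (val y) - f y).
rewrite -[LHS](@real_scalarK R k) -tE mulrBr.
have := gG (val (t *: y), re_of f (t *: y)) (ex_intro _ _ erefl).
rewrite /re_of /= !linearZ/= => h.
by rewrite scalar_reD scalerN scalar_reN [X in X - _]h subrr.
Qed.

End build.

(** * Adjoints, biduals and total smoothness *)

Section adjoint.
Variables (R : realType) (k : scalar_kind).
Local Notation K := (scalar_field R k).
Variables (V W : normedModType K) (j : {linear V -> W}) (C : R).
Hypothesis jC : forall x, rnorm (j x) <= C * rnorm x.

Lemma adjoint_subproof (g : dual W) : g \o j \in @continuous_linear R k V.
Proof.
have [|f fE] := @bounded_linear_dual R k V (g \o j) (rnorm g * C) (linearP _).
  move=> x; rewrite (le_trans (rnorm_dual g (j x)))// -mulrA.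
  by rewrite ler_wpM2l// rnorm_ge0.
by rewrite -fE; exact: (valP f).
Qed.

Definition adjoint (g : dual W) : dual V := Dual (adjoint_subproof g).

Lemma adjoint_linear : linear adjoint.
Proof. by move=> a g h; apply/val_inj/funext. Qed.

HB.instance Definition _ :=
  GRing.isLinear.Build K (dual W) (dual V) _ adjoint adjoint_linear.

Lemma rnorm_adjoint (g : dual W) : 0 <= C -> rnorm (adjoint g) <= C * rnorm g.
Proof.
move=> C0; apply: rnorm_dual_le => x x1.
rewrite (le_trans (re_of_le g (j x)))// mulrC ler_wpM2r ?rnorm_ge0//.
by rewrite (le_trans (jC x))// ler_piMr.
Qed.

End adjoint.

Section bidual.
Variables (R : realType) (k : scalar_kind).
Local Notation K := (scalar_field R k).
Variable V : normedModType K.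

Lemma rnorm_to_bidual (x : V) : rnorm (to_bidual x) <= 1 * rnorm x.
Proof.
apply: rnorm_dual_le => f f1; rewrite (le_trans (re_of_le f x))//.
by rewrite ler_wpM2r// rnorm_ge0.
Qed.

Lemma rnorm_to_bidualE (x : V) : rnorm (to_bidual x) = rnorm x.
Proof.
apply/eqP; rewrite eq_le (le_trans (rnorm_to_bidual x)) ?mul1r//=.
have [f f1 fx] := norming_functional x.
have := re_of_le (to_bidual x) f.
rewrite [re_of _ _](_ : _ = rnorm x); last first.
  by rewrite /re_of [to_bidual x f]fx real_scalarK.
by move/le_trans; apply; rewrite ler_piMr ?rnorm_ge0.
Qed.

End bidual.

Lemma normr_eq_rnorm (R : realType) (k : scalar_kind)
    (U W : normedModType (scalar_field R k)) (x : U) (y : W) :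
  `|x| = `|y| <-> rnorm x = rnorm y.
Proof. by split=> [|xy]; [rewrite /rnorm => -> | rewrite !rnormE xy]. Qed.

(** Strict convexity of the norm, in the form the triangle inequality meets:
    equality between vectors of equal length forces them to coincide. *)
Definition rotund (R : realType) (k : scalar_kind)
    (V : normedModType (scalar_field R k)) : Prop := forall x y : V,
  rnorm x = rnorm y -> rnorm x + rnorm y <= rnorm (x + y) -> x = y.

(** Restricting a norm-preserving extension from the bidual to V gives a
    norm-preserving extension f2 of f; two such have a sum of norm at least
    2 |f|, so strict convexity makes them equal, and property U does the
    rest. Existence comes from Hahn-Banach inside V. *)
Lemma totally_smooth_bidual (R : realType) (k : scalar_kind)
    (V : normedModType (scalar_field R k)) :
  rotund (dual V) -> property_U (@to_bidual R k V) ->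
  totally_smooth (@to_bidual R k V).
Proof.
move=> dual_rotund U Y _ f.
have ext_ge (h : dual V) (a : R) : 0 <= a ->
    (forall y, h (val y) = real_scalar a * f y) -> a * rnorm f <= rnorm h.
  move=> a0 hf; rewrite -rnormZr//; apply: rnorm_dual_le => y y1.
  have -> : re_of (real_scalar a *: f) y = re_of h (val y) by rewrite /re_of hf.
  rewrite (le_trans (re_of_le h _))//.
  by rewrite ler_piMr ?rnorm_ge0.
have ext_ge1 (h : dual V) : (forall y, h (val y) = f y) -> rnorm f <= rnorm h.
  by move=> hf; rewrite -[leLHS]mul1r ext_ge// => y; rewrite real_scalar1 mul1r.
have restrict_le (g : dual (dual (dual V))) :
    rnorm (adjoint (@rnorm_to_bidual R k V) g) <= rnorm g.
  by rewrite (le_trans (rnorm_adjoint _ _ _))// mul1r.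
have [f1 f1f f1E] := hahn_banach_subspace f.
have g1E : rnorm (to_bidual f1) = rnorm f.
  apply/eqP; rewrite eq_le (le_trans (rnorm_to_bidual f1)) ?mul1r//=.
  by rewrite (le_trans _ (restrict_le _))// ext_ge1.
exists (to_bidual f1); split; first by split=> //; apply/normr_eq_rnorm.
move=> g [gE /normr_eq_rnorm gf].
pose f2 := adjoint (@rnorm_to_bidual R k V) g.
have f1n : rnorm f1 = rnorm f by apply/eqP; rewrite eq_le f1f ext_ge1.
have f2n : rnorm f2 = rnorm f.
  by apply/eqP; rewrite eq_le -{1}gf restrict_le ext_ge1.
have f12 : f1 = f2.
  apply: dual_rotund; first by rewrite f1n f2n.
  have -> : rnorm f1 + rnorm f2 = 2 * rnorm f by rewrite f1n f2n; ring.
  rewrite ext_ge// => y; transitivity (f1 (val y) + f2 (val y)) => //.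
  by rewrite f1E [f2 _]gE [real_scalar 2](real_scalarD k 1 1) !real_scalar1
    mulrDl !mul1r.
have [g' [_ g'U]] := U f1.
transitivity g'; first apply: esym.
  by apply: g'U; split=> //; apply/normr_eq_rnorm; rewrite f1n.
apply: g'U; split; last by apply/normr_eq_rnorm; rewrite f1n.
by move=> x; rewrite f12.
Qed.

(** Two functionals of norm 1 with value 1 at x have a sum of norm 2. *)
Lemma smooth_rotund_dual (R : realType) (k : scalar_kind)
    (V : normedModType (scalar_field R k)) : rotund (dual V) -> smooth V.
Proof.
move=> dual_rotund x x1.
have rx : rnorm x = 1 by rewrite /rnorm x1 -real_scalar1 real_scalarK.
have norm1 (f : dual V) : f x = 1 -> 1 <= rnorm f.
  move=> fx; have := re_of_le f x.
  by rewrite /re_of fx rx mulr1 -{1}real_scalar1 real_scalarK.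
have [f f1 fx] := norming_functional x.
rewrite rx real_scalar1 in fx.
exists f; split.
  split=> //; rewrite rnormE -real_scalar1; congr real_scalar.
  by apply/eqP; rewrite eq_le f1 norm1.
move=> g [g1 gx]; have rg : rnorm g = 1.
  by rewrite /rnorm g1 -real_scalar1 real_scalarK.
have rf : rnorm f = 1 by apply/eqP; rewrite eq_le f1 norm1.
apply: dual_rotund; rewrite rf rg//.
have := re_of_le (f + g) x; rewrite rx mulr1.
have -> : re_of (f + g) x = re_of f x + re_of g x by rewrite /re_of -scalar_reD.
by rewrite /re_of fx gx -real_scalar1 real_scalarK.
Qed.

(** * Very smoothness *)

Lemma ultrafilter_bounded_cvg (R : realType) (T : Type) (U : set_system T)
    (phi : T -> R) (M : R) : UltraFilter U ->
  (\forall t \near U, `|phi t| <= M) ->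
  exists l : R, phi @ U --> l.
Proof.
move=> UU phiM.
have [|l [_ phil]] := @segment_compact R (- M) M (phi @ U) _.
  by apply: filterS phiM => t phit; rewrite /= in_itv /= -ler_norml.
exists l => B Bl; have [//|UnB] := in_ultra_setVsetC (phi @^-1` B) UU.
by have [r [nBr Br]] := phil (~` B) B UnB Bl.
Qed.

Lemma weak_cvg (R : realType) (k : scalar_kind)
    (V : normedModType (scalar_field R k)) (T : Type) (F : set_system T)
    (g : T -> V) (l : V) : Filter F ->
  (forall (f : dual V) (e : R), 0 < e ->
    \forall t \near F, rnorm (f (g t) - f l) < e) ->
  (g : T -> weak V) @ F --> (l : weak V).
Proof.
move=> FF cvg_f A [_ [[W oW <-] Wl] WA].
pose ev (x : V) : {ptws dual V -> (scalar_field R k : topologicalType)} :=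
  fun f => f x.
suff cv : (ev \o g) @ F --> ev l.
  have FW : F ((ev \o g) @^-1` W) := cv W (open_nbhs_nbhs (conj oW Wl)).
  apply: (@filterS _ F FF _ _ _ FW) => t Wt; exact: WA.
apply/(@pointwise_cvgP (dual V) (scalar_field R k)) => f.
apply/(@cvgrPdist_lt _ (scalar_field R k)^o) => e e0.
have re0 : 0 < scalar_re e.
  by rewrite -(@ltr_real_scalar R k) real_scalar0 scalar_reK// ltW.
apply: filterS (cvg_f f _ re0) => t.
rewrite -(@ltr_real_scalar R k) -rnormE (scalar_reK (ltW e0)).
by rewrite -normrN opprB.
Qed.

(** If weak convergence of the support functionals s y to s x failed at some
    Psi, an ultrafilter U converging to x would avoid a set A on which
    Psi (s y) is close to Psi (s x). The limits along U of the numbers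
    Psi (s y) form a functional L of norm at most 1 on the bidual whose
    restriction supports x. By smoothness and property U, L is evaluation at
    s x, contradicting the choice of U. *)
Lemma very_smooth_bidual (R : realType) (k : scalar_kind)
    (V : normedModType (scalar_field R k)) :
  smooth V -> property_U (@to_bidual R k V) -> very_smooth V.
Proof.
move=> smV UV; split=> //; apply/subspace_continuousP => x x1.
pose S := [set y : V | `|y| = 1]; pose s := @support_map R k V.
have sP y : S y -> `|s y| = 1 /\ s y y = 1.
  move=> /smV[f [fP _]].
  exact: (@xgetPex _ 0 [set f : dual V | `|f| = 1 /\ f y = 1]
    (ex_intro _ f fP)).
have s1 y : S y -> rnorm (s y) = 1.
  by move=> /sP[sy _]; rewrite /rnorm sy -real_scalar1 real_scalarK.
have re1 (Psi : dual (dual V)) (e : R) : 0 < e ->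
    \forall y \near within S (nbhs x), `|re_of Psi (s y - s x)| < e.
  move=> e0; apply: contrapT => nA.
  set A := (X in ~ within S (nbhs x) X) in nA.
  pose G := within (~` A) (within S (nbhs x)).
  have GP : ProperFilter G.
    apply: Build_ProperFilter_ex => B GB; apply: contrapT => nB; apply: nA.
    apply: (@filterS _ (within S (nbhs x)) _ _ _ _ GB) => y yB.
    apply: contrapT => nAy.
    by apply: nB; exists y; exact: yB.
  have [U [UU GU]] := ultraFilterLemma GP.
  have US : U S by apply: GU; apply: (@filterE _ (nbhs x)) => y Sy _.
  have UnA : U (~` A) by apply: GU; apply: (@filterE _ (nbhs x)) => y _ nAy.
  have Ux (d : R) : 0 < d -> U [set y | rnorm (x - y) < d].
    move=> d0; apply: GU; rewrite /G.
    have d0' : 0 < real_scalar d :> scalar_field R k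
      by rewrite -real_scalar0 ltr_real_scalar.
    apply: (@filterS _ (nbhs x) _ _ _ _
      (nbhsx_ballx x (real_scalar d) d0')) => y.
    by rewrite -ball_normE /= rnormE ltr_real_scalar.
  have Ubnd (Psi1 : dual (dual V)) :
      \forall y \near U, `|re_of Psi1 (s y)| <= rnorm Psi1.
    apply: filterS US => y Sy; have := rnorm_dual Psi1 (s y).
    by rewrite s1// mulr1; apply: le_trans; exact: scalar_re_le_norm.
  (* Only limits of real parts are taken, so compactness of real segments is
     enough; the scalar-valued functional L is recovered from its real part. *)
  have /choice[u uP] : forall Psi : dual (dual V), exists l : R,
      (fun y => re_of Psi (s y)) @ U --> l.
    by move=> Psi'; exact: ultrafilter_bounded_cvg (Ubnd Psi').
  have uE (Psi1 : dual (dual V)) (l : R) :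
      (fun y => re_of Psi1 (s y)) @ U --> l -> u Psi1 = l.
    by move=> Ul; exact: cvg_unique (uP Psi1) Ul.
  have uD Psi1 Psi2 : u (Psi1 + Psi2) = u Psi1 + u Psi2.
    apply: uE; have -> : (fun y => re_of (Psi1 + Psi2) (s y)) =
        (fun y => re_of Psi1 (s y)) + (fun y => re_of Psi2 (s y)).
      by apply/funext => y; exact: scalar_reD.
    exact: cvgD.
  have uZ r Psi1 : u (real_scalar r *: Psi1) = r * u Psi1.
    apply: uE; have -> : (fun y => re_of (real_scalar r *: Psi1) (s y)) =
        (fun y => r * re_of Psi1 (s y)).
      by apply/funext => y; exact: scalar_re_realM.
    exact: cvgMl_tmp.
  have u1 Psi1 : u Psi1 <= 1 * rnorm Psi1.
    rewrite mul1r; apply: (cvgr_to_le (uP Psi1)).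
    by apply: filterS (Ubnd Psi1) => y; apply: le_trans; exact: ler_norm.
  have [L Lu L1] := real_functional_dual ler01 uD uZ u1.
  pose g := adjoint (@rnorm_to_bidual R k V) L.
  have rx : rnorm x = 1 by rewrite /rnorm x1 -real_scalar1 real_scalarK.
  have g1 : rnorm g <= 1.
    by rewrite (le_trans (rnorm_adjoint _ _ _))// mul1r.
  have regx : re_of g x = 1.
    rewrite -[LHS]/(re_of L (to_bidual x)) Lu.
    apply: uE; apply/cvgrPdist_lt => d d0.
    apply: filterS2 US (Ux d d0) => y Sy yd.
    have -> : 1 - re_of (to_bidual x) (s y) = - re_of (s y) (x - y).
      rewrite re_ofD re_ofN /re_of (sP _ Sy).2 -real_scalar1 real_scalarK.
      by rewrite opprB.
    rewrite normrN (le_lt_trans (scalar_re_le_norm _))//.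
    by rewrite (le_lt_trans (rnorm_dual _ _))// s1// mul1r.
  have rgx : rnorm (g x) <= 1.
    by rewrite (le_trans (rnorm_dual g x))// rx mulr1.
  have rgx1 : rnorm (g x) = 1.
    apply/eqP; rewrite eq_le rgx -[leLHS]regx (le_trans (ler_norm _))//.
    exact: scalar_re_le_norm.
  have gx : g x = 1.
    have := @scalar_eq_re R k (g x); rewrite [scalar_re (g x)]regx.
    by move=> /(_ rgx) ->; rewrite rnormE rgx1 real_scalar1.
  have rg1 : rnorm g = 1.
    apply/eqP; rewrite eq_le g1 (le_trans _ (_ : rnorm (g x) <= _))//.
      by rewrite rgx1.
    by rewrite (le_trans (rnorm_dual g x))// rx mulr1.
  have gsx : g = s x.
    have [f [_ fU]] := smV x x1.
    rewrite -(fU g); last first.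
      by split=> //; rewrite rnormE rg1 real_scalar1.
    by apply: fU; exact: sP.
  have Lsx : L = to_bidual (s x).
    have [h [_ hU]] := UV (s x).
    have rL : rnorm L = 1.
      apply/eqP; rewrite eq_le L1 -rg1 (le_trans (rnorm_adjoint _ _ _))//.
      by rewrite mul1r.
    rewrite -(hU L); last first.
      split; first by move=> y; rewrite -gsx.
      by apply/normr_eq_rnorm; rewrite rL s1.
    by apply: hU; split=> //; apply/normr_eq_rnorm; rewrite rnorm_to_bidualE.
  have uPsi : u Psi = re_of Psi (s x) by rewrite -Lu Lsx.
  have := uP Psi; rewrite uPsi => /cvgrPdist_lt/(_ e e0) UA.
  suff [y [yA ynA]] : (A `&` ~` A) !=set0 by exact: ynA.
  apply: (@filter_ex _ U); apply: filterI => //.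
  apply: filterS UA => y; rewrite /A /= distrC.
  by rewrite re_ofD re_ofN.
have [c cP] := @scalar_norm_le_re2 R k.
apply: (@weak_cvg R k (dual V) V _ s (s x)) => Psi e e0.
have e2 : 0 < e / 2 by rewrite divr_gt0.
apply: (@filterS _ (within S (nbhs x)) _ _ _ _
  (filterI (re1 Psi _ e2) (re1 (c *: Psi) _ e2))) => y [h1 h2].
have -> : Psi (s y) - Psi (s x) = Psi (s y - s x) by rewrite linearB.
by rewrite (splitr e) (le_lt_trans (cP _))// ltrD.
Qed.

(** * Enlarging the dual norm by a support function *)

(** The two identity maps between V and its renorming, as linear maps, so that
    functionals can be transported by taking adjoints. *)
Definition forget_norm (K : numFieldType) (V : lmodType K) (N : norm_on V)
  (x : with_norm N) : V := x.

HB.instance Definition _ (K : numFieldType) (V : lmodType K) (N : norm_on V) :=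
  GRing.isLinear.Build K (with_norm N) V _ (@forget_norm K V N)
    (fun a x y => erefl).

Definition add_norm (K : numFieldType) (V : lmodType K) (N : norm_on V)
  (x : V) : with_norm N := x.

HB.instance Definition _ (K : numFieldType) (V : lmodType K) (N : norm_on V) :=
  GRing.isLinear.Build K V (with_norm N) _ (@add_norm K V N)
    (fun a x y => erefl).

Section support_function.
Variables (R : realType) (k : scalar_kind).
Local Notation K := (scalar_field R k).
Variables (X : normedModType K) (C : set X).
Implicit Types (f g : dual X) (s : X).

Definition support_function f : R := sup [set re_of f s | s in C].
Local Notation h := support_function.

Hypothesis C0 : C 0.
Hypothesis C1 : forall s, C s -> rnorm s <= 1.
Hypothesis Crot : forall (t : K^o) s, rnorm t <= 1 -> C s -> C (t *: s).

Lemma support_function_has_sup f : has_sup [set re_of f s | s in C].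
Proof.
split; first by exists (re_of f 0), 0.
exists (rnorm f) => _ [s Cs <-]; rewrite (le_trans (re_of_le f s))//.
by rewrite ler_piMr ?rnorm_ge0// C1.
Qed.

Lemma support_function_ub f s : C s -> re_of f s <= h f.
Proof.
by move=> Cs; apply: ub_le_sup; [case: (support_function_has_sup f)|exists s].
Qed.

Lemma support_function_le f M : (forall s, C s -> re_of f s <= M) -> h f <= M.
Proof.
move=> fM; apply: ge_sup; first by case: (support_function_has_sup f).
by move=> _ [s Cs <-]; exact: fM.
Qed.

Lemma support_function_ge0 f : 0 <= h f.
Proof.
by have := support_function_ub f C0; rewrite /re_of linear0 scalar_re0.
Qed.

Lemma support_function_le_norm f : h f <= rnorm f.
Proof.
apply: support_function_le => s Cs; rewrite (le_trans (re_of_le f s))//.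
by rewrite ler_piMr ?rnorm_ge0// C1.
Qed.

Lemma support_functionD f g : h (f + g) <= h f + h g.
Proof.
apply: support_function_le => s Cs.
rewrite (_ : re_of _ _ = re_of f s + re_of g s); last exact: scalar_reD.
by rewrite lerD// support_function_ub.
Qed.

Lemma support_functionZ (a : K^o) f : h (a *: f) = rnorm a * h f.
Proof.
have le (b : K^o) g : h (b *: g) <= rnorm b * h g.
  apply: support_function_le => s Cs.
  have [->|b0] := eqVneq b 0.
    by rewrite rnorm0 mul0r scale0r /re_of scalar_re0.
  have -> : re_of (b *: g) s = rnorm b * re_of g ((b / `|b|) *: s).
    rewrite /re_of linearZ/= -scalar_re_realM -rnormE; congr scalar_re.
    transitivity (`|b| * (b / `|b|) * g s); last by rewrite -mulrA.
    by rewrite [`|b| * (_ / _)]mulrC mulfVK ?normr_eq0.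
  rewrite ler_wpM2l ?rnorm_ge0//; apply/support_function_ub/Crot => //.
  by rewrite /rnorm normrM normfV normr_id divff ?normr_eq0// -real_scalar1
    real_scalarK.
apply/eqP; rewrite eq_le le/=.
have [->|a0] := eqVneq a 0; first by rewrite rnorm0 mul0r support_function_ge0.
have ra : 0 < rnorm a.
  rewrite lt_neqAle rnorm_ge0 andbT eq_sym; apply/eqP => /rnorm0_eq0 a00.
  by rewrite a00 eqxx in a0.
rewrite -ler_pdivlMl//.
apply: (@le_trans _ _ (rnorm (a^-1 : K^o) * h (a *: f))).
  by have := le a^-1 (a *: f); rewrite scalerA mulVf// scale1r.
rewrite ler_wpM2r ?support_function_ge0//.
rewrite -(ler_pM2l ra) mulfV ?gt_eqF// -(@rnormZ R k K^o) [_ *: _]mulfV//.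
by rewrite /rnorm normr1 -real_scalar1 real_scalarK.
Qed.

Definition augmented_norm_fun f : K := real_scalar (rnorm f + h f).

Lemma augmented_normD f g :
  augmented_norm_fun (f + g) <= augmented_norm_fun f + augmented_norm_fun g.
Proof.
rewrite -real_scalarD ler_real_scalar addrACA lerD ?rnormD//.
exact: support_functionD.
Qed.

Lemma augmented_normZ (a : K) f :
  augmented_norm_fun (a *: f) = `|a| * augmented_norm_fun f.
Proof.
rewrite /augmented_norm_fun rnormZ support_functionZ -mulrDr real_scalarM.
by rewrite -rnormE.
Qed.

Lemma augmented_norm_eq0 f : augmented_norm_fun f = 0 -> f = 0.
Proof.
move=> /(congr1 (@scalar_re R k)); rewrite real_scalarK scalar_re0 => f0.
apply: rnorm0_eq0; have := rnorm_ge0 f; have := support_function_ge0 f; lra.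
Qed.

Definition augmented_norm : norm_on (dual X) :=
  NormOn augmented_normD augmented_normZ augmented_norm_eq0.

Local Notation Q := (with_norm augmented_norm).

Lemma rnorm_augmented (f : Q) : rnorm f = rnorm (f : dual X) + h f.
Proof. exact: real_scalarK. Qed.

Lemma forget_augmented_le (f : Q) :
  rnorm (forget_norm f) <= 1 * rnorm f.
Proof. by rewrite mul1r rnorm_augmented lerDl support_function_ge0. Qed.

(** The predual of the augmented norm: x is measured as a functional on X^*
    with that norm, so the norm axioms are those of a dual norm. *)
Definition augmented_evaluation (x : X) : dual Q :=
  adjoint forget_augmented_le (to_bidual x).
Local Notation ev := augmented_evaluation.

Lemma augmented_evaluationE x (f : Q) : ev x f = (f : dual X) x.
Proof. by []. Qed.

Lemma predualD x y : `|ev (x + y)| <= `|ev x| + `|ev y|.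
Proof. by rewrite /ev !linearD ler_normD. Qed.

Lemma predualZ (a : K) x : `|ev (a *: x)| = `|a| * `|ev x|.
Proof. by rewrite /ev !linearZ/= normrZ. Qed.

Lemma predual_eq0 x : `|ev x| = 0 -> x = 0.
Proof.
move=> /normr0_eq0 ex0; have [f _ fx] := norming_functional x.
apply: rnorm0_eq0; rewrite -[LHS](@real_scalarK R k) -fx.
by rewrite -[f x]/(ev x f) ex0 scalar_re0.
Qed.

Definition predual_norm : norm_on X := NormOn predualD predualZ predual_eq0.
Local Notation N := predual_norm.
Local Notation XN := (with_norm predual_norm).

Lemma rnorm_predual (x : XN) : rnorm x = rnorm (ev x).
Proof. by []. Qed.

Lemma add_norm_le x : rnorm (add_norm N x) <= 1 * rnorm x.
Proof.
rewrite rnorm_predual (le_trans (rnorm_adjoint _ _ _))//.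
by rewrite !mul1r rnorm_to_bidualE.
Qed.

Lemma forget_norm_le (x : XN) : rnorm (forget_norm x) <= 2 * rnorm x.
Proof.
have [f f1 fx] := norming_functional (x : X).
have := re_of_le (ev x) f.
rewrite [re_of _ _](_ : _ = rnorm (x : X)); last first.
  by rewrite /re_of augmented_evaluationE fx real_scalarK.
move=> /le_trans; apply; rewrite mulrC ler_wpM2r ?rnorm_ge0//.
by rewrite rnorm_augmented; have := support_function_le_norm f; lra.
Qed.

Lemma predual_norm_equivalent : equivalent_norm N.
Proof.
exists (real_scalar (2^-1)), 1; split=> //.
  by rewrite -real_scalar0 ltr_real_scalar invr_gt0.
move=> x; have := add_norm_le x; have := forget_norm_le x.
rewrite -[N x]/(`|add_norm N x|) [`|x|]rnormE [`|add_norm _ _|]rnormE.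
rewrite -real_scalarM !mul1r !ler_real_scalar => h1 h2; split=> //.
by rewrite ler_pdivrMl.
Qed.

Local Notation pull := (adjoint add_norm_le).

(** The points z + s are those at which the augmented norm is attained as a
    supremum; that they are in the unit ball of the predual norm shows that
    the dual of the predual norm is no smaller than the augmented norm. *)
Lemma predual_norm_add_le z s :
  rnorm z <= 1 -> C s -> rnorm (add_norm N (z + s)) <= 1.
Proof.
move=> z1 Cs; rewrite rnorm_predual; apply: rnorm_dual_le => f f1.
apply: le_trans f1; rewrite [re_of _ _](_ : _ = re_of (f : dual X) (z + s))//.
rewrite re_ofD rnorm_augmented lerD ?support_function_ub//.
by rewrite (le_trans (re_of_le _ _))// ler_piMr ?rnorm_ge0.
Qed.

(** The augmented norm is a dual norm. No bipolar theorem is involved: the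
    unit ball of the predual norm contains all z + s, and the supremum of a
    functional over them splits into two independent suprema. *)
Lemma rnorm_dual_predual (g : dual XN) : rnorm g = rnorm (pull g) + h (pull g).
Proof.
apply/eqP; rewrite eq_le; apply/andP; split.
  apply: rnorm_dual_le => x x1; rewrite -(rnorm_augmented (pull g)).
  have := re_of_le (ev x) (pull g); rewrite -rnorm_predual.
  by move=> /le_trans; apply; rewrite ler_piMl ?rnorm_ge0.
rewrite -lerBrDr; apply: rnorm_dual_le => z z1.
rewrite lerBrDr addrC -lerBrDr; apply: support_function_le => s Cs.
rewrite lerBrDr addrC -re_ofD (le_trans (re_of_le g (add_norm N (z + s))))//.
by rewrite ler_piMr ?rnorm_ge0// predual_norm_add_le.
Qed.

Lemma rotund_dual_predual : rotund Q -> rotund (dual XN).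
Proof.
move=> rot f g; rewrite !rnorm_dual_predual linearD => fg fgD.
have pfg : pull f = pull g.
  by apply: (rot (pull f) (pull g)); rewrite !rnorm_augmented.
by apply: re_of_inj => x;
  exact: (congr1 (fun u : dual X => re_of u (forget_norm x)) pfg).
Qed.

Lemma pull_le (g : dual XN) : rnorm (pull g) <= 1 * rnorm g.
Proof. exact: rnorm_adjoint. Qed.

Lemma push_le (f : dual X) : rnorm (adjoint forget_norm_le f) <= 2 * rnorm f.
Proof. exact: rnorm_adjoint. Qed.

(** An extension g of f to the renormed bidual is carried to pull3 g on the
    original one. Testing g on pull2 Phi + s with Phi in the original unit ball
    and s in C, and taking suprema, bounds the norm of pull3 g plus h (pull f)
    by the norm of f, which is the norm of pull f plus h (pull f). Thus pull3 g
    is a norm-preserving extension of pull f, to which property U applies. *)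
Lemma predual_property_U :
  property_U (@to_bidual R k X) -> property_U (@to_bidual R k XN).
Proof.
move=> U f; exists (to_bidual f); split.
  by split=> //; apply/normr_eq_rnorm; rewrite rnorm_to_bidualE.
move=> g [gE /normr_eq_rnorm gf].
have pull2_le := fun Phi => @rnorm_adjoint R k _ _ _ _ pull_le Phi ler01.
pose pull2 := adjoint pull_le; pose pull3 := adjoint pull2_le.
have g'E x : pull3 g (to_bidual x) = pull f x.
  by rewrite -[RHS]gE; congr (g _); exact/val_inj/funext.
have g'le : rnorm (pull3 g) <= rnorm (pull f).
  apply: rnorm_dual_le => Phi Phi1.
  rewrite -(lerD2r (h (pull f))) -rnorm_dual_predual addrC -lerBrDr.
  apply: support_function_le => s Cs; rewrite lerBrDr.
  have <- : re_of g (pull2 Phi + to_bidual (add_norm N s)) =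
      re_of (pull f) s + re_of (pull3 g) Phi.
    by rewrite re_ofD addrC; congr (_ + _); rewrite /re_of gE.
  rewrite (le_trans (re_of_le _ _))// gf ler_piMr ?rnorm_ge0//.
  apply: rnorm_dual_le => phi phi1.
  have -> : re_of (pull2 Phi + to_bidual (add_norm N s)) phi =
      re_of Phi (pull phi) + re_of (pull phi) s by exact: scalar_reD.
  apply: le_trans phi1; rewrite rnorm_dual_predual.
  rewrite lerD ?support_function_ub// (le_trans (re_of_le _ _))//.
  by rewrite ler_piMl ?rnorm_ge0.
have g'ge : rnorm (pull f) <= rnorm (pull3 g).
  have -> : pull f = adjoint (@rnorm_to_bidual R k X) (pull3 g).
    by apply/val_inj/funext => x; exact: (esym (g'E x)).
  by rewrite (le_trans (rnorm_adjoint _ _ _))// mul1r.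
have g'J : pull3 g = to_bidual (pull f).
  have [v [_ vU]] := U (pull f); transitivity v; last first.
    by apply: vU; split=> //; apply/normr_eq_rnorm; rewrite rnorm_to_bidualE.
  apply/esym/vU; split=> //; apply/normr_eq_rnorm/eqP.
  by rewrite eq_le g'le g'ge.
(* The two norms are equivalent, so every Psi in the new bidual comes from the
   old one, and pull3 is injective. *)
apply/val_inj/funext => Psi.
pose Phi := adjoint push_le Psi.
have PsiE : Psi = pull2 Phi.
  apply/val_inj/funext => phi; congr (Psi _); exact/val_inj/funext.
by rewrite /= [in RHS]PsiE -[RHS]/(pull3 g Phi) g'J PsiE.
Qed.

End support_function.

(** * Strict convexity *)

(** With A = h f and B = h g, the vectors u = B f and v = A g have the same
    length A B, and h (u + v) >= 2 A B because u + v differs from a multiple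
    max(A, B) of f + g only by |A - B| times f or g. The parallelogram law
    leaves no room for u - v. *)
Lemma parallelogram_aligned (R : realType) (k : scalar_kind)
    (V : lmodType (scalar_field R k)) (h : V -> R) :
  (forall u v, h (u + v) <= h u + h v) ->
  (forall r u, 0 <= r -> h (real_scalar r *: u) = r * h u) ->
  (forall u, 0 <= h u) -> (forall u, h u = 0 -> u = 0) ->
  (forall u v, h (u + v) ^+ 2 + h (u - v) ^+ 2 <=
     h u ^+ 2 *+ 2 + h v ^+ 2 *+ 2) ->
  forall f g, h f + h g <= h (f + g) ->
    real_scalar (h g) *: f = real_scalar (h f) *: g.
Proof.
move=> hD hZ h_ge0 h_eq0 para f g.
have := h_ge0 f; have := h_ge0 g; set A := h f; set B := h g => B0 A0 fg.
set u := real_scalar B *: f; set v := real_scalar A *: g.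
have hu : h u = A * B by rewrite hZ// mulrC.
have hv : h v = A * B by rewrite hZ.
have huv : A * B *+ 2 <= h (u + v).
  have [AB|/ltW BA] := lerP A B.
    have uvE : real_scalar B *: (f + g) = u + v + real_scalar (B - A) *: g.
      rewrite scalerDr -addrA -scalerDl -real_scalarD; congr (_ + _ *: _).
      by rewrite addrC subrK.
    have := hD (u + v) (real_scalar (B - A) *: g).
    rewrite -uvE !hZ ?subr_ge0// -/B => le1.
    have le2 := ler_wpM2l B0 fg; lra.
  have uvE : real_scalar A *: (f + g) = u + v + real_scalar (A - B) *: f.
    rewrite scalerDr addrAC -scalerDl -real_scalarD; congr (_ *: _ + _).
    by rewrite addrC subrK.
  have := hD (u + v) (real_scalar (A - B) *: f).
  rewrite -uvE !hZ ?subr_ge0// -/A => le1.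
  have le2 := ler_wpM2l A0 fg; lra.
apply/eqP; rewrite -subr_eq0; apply/eqP/h_eq0/eqP.
rewrite -sqrf_eq0 eq_le sqr_ge0 andbT.
have := para u v; rewrite hu hv.
have : (A * B *+ 2) ^+ 2 <= h (u + v) ^+ 2.
  by rewrite lerXn2r// nnegrE ?h_ge0// mulrn_wge0// mulr_ge0.
by move=> le1 le2; lra.
Qed.

(** Equality in the triangle inequality for the sum of the two norms forces
    equality for h alone, hence f and g are aligned; equal augmented norms then
    force equal length. *)
Lemma rotund_augmented (R : realType) (k : scalar_kind)
    (X : normedModType (scalar_field R k)) (C : set X) (C0 : C 0)
    (C1 : forall s, C s -> rnorm s <= 1)
    (Crot : forall (t : (scalar_field R k)^o) s,
      rnorm t <= 1 -> C s -> C (t *: s)) :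
  let h := support_function C in
  (forall f g : dual X, h (f + g) ^+ 2 + h (f - g) ^+ 2 <=
     h f ^+ 2 *+ 2 + h g ^+ 2 *+ 2) ->
  (forall f : dual X, h f = 0 -> f = 0) ->
  rotund (with_norm (augmented_norm C0 C1 Crot)).
Proof.
move=> h para h_eq0 f g.
have rE := @rnorm_augmented R k X C C0 C1 Crot.
rewrite (rE f) (rE g) (rE (f + g)) => fg fgD.
(* From here on f and g are read in X^* with its original norm. *)
move: f g fg fgD; change (forall f g : dual X,
  rnorm f + h f = rnorm g + h g ->
  rnorm f + h f + (rnorm g + h g) <= rnorm (f + g) + h (f + g) -> f = g).
move=> f g fg fgD {rE}.
have hD : h f + h g <= h (f + g).
  by have := rnormD f g; lra.
have hZ r (u : dual X) : 0 <= r -> h (real_scalar r *: u) = r * h u.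
  by move=> r0; rewrite /h support_functionZ// rnorm_real_scalar ger0_norm.
have h_ge0 u : 0 <= h u by exact: support_function_ge0.
have aligned : real_scalar (h g) *: f = real_scalar (h f) *: g :=
  parallelogram_aligned (support_functionD C0 C1) hZ h_ge0 h_eq0 para hD.
have := congr1 (@rnorm R k (dual X)) aligned; rewrite !rnormZr// => nfg.
have hfg : h f = h g.
  apply/eqP; apply: contraT => ne.
  have : (h g - h f) * (rnorm g + h g) = 0.
    have nf : rnorm f = rnorm g + h g - h f by lra.
    have -> : (h g - h f) * (rnorm g + h g) =
        h g * (rnorm g + h g - h f) - h f * rnorm g by ring.
    by rewrite -nf nfg subrr.
  move=> /eqP; rewrite mulf_eq0 subr_eq0 eq_sym (negbTE ne)/= => /eqP ng.
  have g0 := h_ge0 g; have f0 := h_ge0 f.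
  have rg0 := rnorm_ge0 g; have rf0 := rnorm_ge0 f.
  by move/eqP: ne; lra.
have [f0|f0] := eqVneq (h f) 0.
  by rewrite (h_eq0 f f0) (h_eq0 g _)// -hfg.
have := congr1 (fun u => real_scalar (h f)^-1 *: u) aligned.
by rewrite -hfg !scalerA -real_scalarM mulVf// real_scalar1 !scale1r.
Qed.

(** * The square-summable hull of a sequence *)

(** Expand the squares (P a_i - b_i)^2, where P is the sum of the a_i b_i. *)
Lemma cauchy_schwarz_unit (R : realType) n (a b : 'I_n -> R) :
  \sum_i a i ^+ 2 <= 1 -> (\sum_i a i * b i) ^+ 2 <= \sum_i b i ^+ 2.
Proof.
set A := \sum_i _; set P := \sum_i _; set S := \sum_i _ => A1.
have : 0 <= \sum_i (P * a i - b i) ^+ 2.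
  by apply: sumr_ge0 => i _; exact: sqr_ge0.
have -> : \sum_i (P * a i - b i) ^+ 2 = P ^+ 2 * A - P ^+ 2 *+ 2 + S.
  have -> : P ^+ 2 *+ 2 = \sum_i (P * (a i * b i)) *+ 2.
    by rewrite sumrMnl -mulr_sumr.
  rewrite mulr_sumr -sumrB -big_split/=; apply: eq_bigr => i _; ring.
have := ler_wpM2l (sqr_ge0 P) A1; lra.
Qed.

Section square_summable.
Variables (R : realType) (k : scalar_kind).
Local Notation K := (scalar_field R k).
Variables (X : normedModType K) (y : nat -> X).
Hypothesis y_small : forall i, rnorm (y i) <= 2^-1 ^+ i.+1.
Hypothesis y_total : forall f : dual X, (forall i, f (y i) = 0) -> f = 0.

(** The image, under a |-> sum_i a_i y_i, of the finitely supported part of the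
    unit ball of l^2; its support function at f is the l^2 norm of the sequence
    of values f (y_i). *)
Definition square_summable_hull : set X := [set s | exists n (a : 'I_n -> K^o),
  \sum_i rnorm (a i) ^+ 2 <= 1 /\ s = \sum_i a i *: y i].
Local Notation C := square_summable_hull.
Local Notation h := (support_function C).

Lemma rnorm_sum (V : normedModType K) n (v : 'I_n -> V) :
  rnorm (\sum_i v i) <= \sum_i rnorm (v i).
Proof.
apply: (big_ind2 (fun (w : V) (r : R) => rnorm w <= r)) => //.
  by rewrite rnorm0.
by move=> w r w' r' wr wr'; rewrite (le_trans (rnormD _ _))// lerD.
Qed.

Lemma square_summable_hull0 : C 0.
Proof. by exists 0%N, (fun=> 0); rewrite !big_ord0 ler01. Qed.

Lemma square_summable_hull1 s : C s -> rnorm s <= 1.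
Proof.
move=> [n [a [a1 ->]]].
have ai1 i : rnorm (a i) <= 1.
  rewrite -(@expr_le1 _ 2) ?rnorm_ge0// (le_trans _ a1)//.
  by rewrite (bigD1 i)//= lerDl; apply: sumr_ge0 => j _; exact: sqr_ge0.
rewrite (le_trans (rnorm_sum _))//.
apply: (@le_trans _ _ (\sum_(i < n) 2^-1 ^+ i.+1)).
  apply: ler_sum => i _; rewrite rnormZ (le_trans _ (y_small i))//.
  by rewrite ler_piMl ?rnorm_ge0.
have -> : \sum_(i < n) (2^-1 : R) ^+ i.+1 = 1 - 2^-1 ^+ n.
  elim: n {a a1 ai1} => [|n IH]; first by rewrite big_ord0 expr0 subrr.
  by rewrite big_ord_recr/= IH exprS; lra.
by rewrite lerBlDr lerDl exprn_ge0.
Qed.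

Lemma square_summable_hull_rotate (t : K^o) s :
  rnorm t <= 1 -> C s -> C (t *: s).
Proof.
move=> t1 [n [a [a1 ->]]]; exists n, (fun i => t *: a i); split.
  apply: le_trans a1; apply: ler_sum => i _.
  rewrite rnormZ exprMn ler_piMl ?sqr_ge0//.
  by rewrite expr_le1// rnorm_ge0.
by rewrite scaler_sumr; apply: eq_bigr => i _; rewrite scalerA.
Qed.

Definition partial_square n (f : dual X) : R :=
  \sum_(i < n) rnorm (f (y i)) ^+ 2.

Lemma partial_square_mono m n f :
  (m <= n)%N -> partial_square m f <= partial_square n f.
Proof.
move=> mn; rewrite -(subnKC mn); elim: (n - m)%N => [|d IH].
  by rewrite addn0.
by rewrite addnS (le_trans IH)// /partial_square big_ord_recr/= lerDl sqr_ge0.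
Qed.

Lemma re_of_sqr_le f s : C s -> exists n, re_of f s ^+ 2 <= partial_square n f.
Proof.
move=> [n [a [a1 ->]]]; exists n.
apply: le_trans (cauchy_schwarz_unit (fun i : 'I_n => rnorm (f (y i))) a1).
rewrite -real_normK ?num_real// lerXn2r// ?nnegrE//.
  by apply: sumr_ge0 => i _; rewrite mulr_ge0 ?rnorm_ge0.
rewrite (le_trans (scalar_re_le_norm _))// linear_sum.
rewrite (le_trans (rnorm_sum _))//.
by apply: ler_sum => i _; rewrite linearZ/= rnormZ.
Qed.

(** The extremal coefficients are a_i = t_i |f (y_i)| / r, where t_i rotates
    f (y_i) to its modulus and r^2 is the partial sum of squares. *)
Lemma partial_square_le n f : partial_square n f <= h f ^+ 2.
Proof.
set S := partial_square n f.
have S0 : 0 <= S by apply: sumr_ge0 => i _; exact: sqr_ge0.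
have [->|Sn0] := eqVneq S 0; first exact: sqr_ge0.
have r0 : 0 < Num.sqrt S by rewrite sqrtr_gt0 lt_neqAle eq_sym Sn0.
have rS := sqr_sqrtr S0; set r := Num.sqrt S in r0 rS.
rewrite -rS lerXn2r ?nnegrE ?(ltW r0)//.
  exact: support_function_ge0 square_summable_hull0 square_summable_hull1 _.
have /choice[t tP] : forall i, exists t : K^o,
    rnorm t <= 1 /\ t * f (y i) = real_scalar (rnorm (f (y i))).
  by move=> i; have [t t1 tE] := phase_rotation (f (y i)); exists t.
pose b i := rnorm (f (y i)).
pose a (i : 'I_n) : K^o := (real_scalar (b i / r) : K) * t i.
have Cs : C (\sum_i a i *: y i).
  exists n, a; split=> //.
  apply: (@le_trans _ _ (\sum_(i < n) b i ^+ 2 / r ^+ 2)); last first.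
    by rewrite -mulr_suml rS mulfV.
  apply: ler_sum => i _; rewrite -expr_div_n lerXn2r// ?nnegrE ?rnorm_ge0//.
    by rewrite divr_ge0 ?rnorm_ge0// ltW.
  rewrite (@rnormZ R k K^o) rnorm_real_scalar ger0_norm; last first.
    by rewrite divr_ge0 ?rnorm_ge0// ltW.
  by rewrite ler_piMr ?(tP i).1// divr_ge0 ?rnorm_ge0// ltW.
have <- : re_of f (\sum_i a i *: y i) = r.
  have fE : f (\sum_i a i *: y i) = real_scalar (\sum_(i < n) b i ^+ 2 / r).
    rewrite linear_sum/=.
    apply: (big_ind2 (fun (z : K^o) (x : R) => z = real_scalar x)).
    - by rewrite real_scalar0.
    - by move=> ? ? ? ? -> ->; rewrite real_scalarD.
    - move=> i _; rewrite linearZ/= -[LHS]mulrA (tP i).2 -real_scalarM.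
      by congr real_scalar; rewrite -/(b i); ring.
  by rewrite /re_of fE real_scalarK -mulr_suml -/(partial_square n f) -/S
    -rS expr2 mulfK// gt_eqF.
exact: (support_function_ub square_summable_hull0 square_summable_hull1).
Qed.

Lemma support_sqr_le f (M : R) :
  (forall n, partial_square n f <= M) -> h f ^+ 2 <= M.
Proof.
move=> fM; have M0 : 0 <= M by have := fM 0%N; rewrite /partial_square big_ord0.
have h0 := support_function_ge0 square_summable_hull0 square_summable_hull1 f.
rewrite -(sqr_sqrtr M0) lerXn2r ?nnegrE ?sqrtr_ge0//.
apply: (support_function_le square_summable_hull0 square_summable_hull1) => s.
move=> Cs.
have [n sn] := re_of_sqr_le f Cs.
rewrite (le_trans (ler_norm _))// -sqrtr_sqr ler_wsqrtr//.
exact: le_trans sn (fM n).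
Qed.

(** The square of h is an increasing limit of sums of squared moduli of linear
    forms, each of which satisfies the parallelogram identity. *)
Lemma support_parallelogram f g : h (f + g) ^+ 2 + h (f - g) ^+ 2 <=
  h f ^+ 2 *+ 2 + h g ^+ 2 *+ 2.
Proof.
rewrite -lerBrDr; apply: support_sqr_le => m.
rewrite lerBrDr addrC -lerBrDr; apply: support_sqr_le => n.
rewrite lerBrDr addrC.
set N := maxn m n.
apply: (@le_trans _ _ (partial_square N (f + g) + partial_square N (f - g))).
  by rewrite lerD// partial_square_mono// ?leq_maxl ?leq_maxr.
have -> : partial_square N (f + g) + partial_square N (f - g) =
    partial_square N f *+ 2 + partial_square N g *+ 2.
  rewrite /partial_square -!sumrMnl -!big_split/=; apply: eq_bigr => i _.
  exact: scalar_parallelogram.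
by rewrite lerD// lerMn2r partial_square_le.
Qed.

Lemma support_eq0 f : h f = 0 -> f = 0.
Proof.
move=> h0; apply: y_total => i; apply: rnorm0_eq0; apply/eqP.
have := partial_square_le i.+1 f; rewrite h0 expr0n/= => le0.
rewrite -sqrf_eq0 eq_le sqr_ge0 andbT (le_trans _ le0)//.
rewrite /partial_square big_ord_recr/= lerDr.
by apply: sumr_ge0 => j _; exact: sqr_ge0.
Qed.

End square_summable.

(** A dense sequence, rescaled to decay geometrically: scaling does not change
    which functionals vanish on it. *)
Lemma separable_total_sequence (R : realType) (k : scalar_kind)
    (X : normedModType (scalar_field R k)) : separable_space X ->
  exists y : nat -> X, (forall i, rnorm (y i) <= 2^-1 ^+ i.+1) /\
    forall f : dual X, (forall i, f (y i) = 0) -> f = 0.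
Proof.
move=> [D cD dD].
have [e De] : exists e : nat -> X, D `<=` range e.
  have /pfcard_geP[D0|[e]] := cD; first by exists (fun=> 0); rewrite D0.
  by exists e => d /(@surj _ _ _ _ e)[i _ <-]; exists i.
pose c i : R := 2^-1 ^+ i.+1 / (1 + rnorm (e i)).
have e1 i : 0 < 1 + rnorm (e i) by rewrite ltr_pwDl// rnorm_ge0.
have c0 i : 0 < c i by rewrite divr_gt0// exprn_gt0.
exists (fun i => real_scalar (c i) *: e i); split=> [i|f f0].
  rewrite rnormZr ?(ltW (c0 i))// /c -mulrA ler_piMr ?exprn_ge0//.
  by rewrite mulrC ler_pdivrMr// mul1r lerDr.
have fe i : f (e i) = 0.
  have /eqP := f0 i.
  rewrite linearZ/= [_ *: _]/(_ * _) mulf_eq0 => /orP[|/eqP//].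
  by rewrite -(real_scalar0 R k) => /eqP /(congr1 (@scalar_re R k));
    rewrite !real_scalarK => ci0; have := c0 i; rewrite ci0 ltxx.
apply/val_inj/funext => x; apply: rnorm0_eq0; apply/eqP; apply: contraT => fx.
have fx0 : 0 < rnorm (f x) by rewrite lt_neqAle eq_sym fx rnorm_ge0.
have nf1 : 0 < 1 + rnorm f by rewrite ltr_pwDl// rnorm_ge0.
pose d := rnorm (f x) / (1 + rnorm f).
have d0 : 0 < d by rewrite divr_gt0.
have d0' : 0 < real_scalar d :> scalar_field R k.
  by rewrite -(real_scalar0 R k) ltr_real_scalar.
have [|z [xz Dz]] := dD (ball x (real_scalar d)) _ (@ball_open _ X x _).
  by exists x; exact: ballxx.
have [i _ ei] := De z Dz.
move: xz; rewrite -ball_normE /= rnormE ltr_real_scalar => xz.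
have := rnorm_dual f (x - z); rewrite linearB/= -ei fe subr0 ei => le1.
have : rnorm f * rnorm (x - z) <= rnorm f * d.
  by rewrite ler_wpM2l ?rnorm_ge0// ltW.
have : (1 + rnorm f) * d = rnorm (f x) by rewrite mulrC divfK// gt_eqF.
lra.
Qed.

Theorem corollary3p3 (R : realType) (k : scalar_kind)
  (X : completeNormedModType (scalar_field R k))
  (X_separable : separable_space X)
  (X_property_U : property_U (@to_bidual R k X)) :
  exists N : norm_on X,
    [/\ equivalent_norm N,
        very_smooth (with_norm N) &
        totally_smooth (@to_bidual R k (with_norm N))].
Proof.
have [y [y_small y_total]] := separable_total_sequence X_separable.
have C0 := square_summable_hull0 y.
have C1 := square_summable_hull1 y_small.
have Crot := @square_summable_hull_rotate R k X y.
have dual_rotund : rotund (dual (with_norm (predual_norm C0 C1 Crot))).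
  apply/rotund_dual_predual/rotund_augmented.
    exact: support_parallelogram.
  exact: support_eq0.
have U := @predual_property_U R k X _ C0 C1 Crot X_property_U.
exists (predual_norm C0 C1 Crot); split.
- exact: predual_norm_equivalent.
- exact: very_smooth_bidual (smooth_rotund_dual dual_rotund) U.
- exact: totally_smooth_bidual dual_rotund U.
Qed.
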